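(* Let $G$ be a (simple) planar graph with maximum degree $\Delta(G)\ge 17$, and let the palette be $\mathcal{K}=\{1,\dots,\Delta(G)+1\}$. Let $M\subseteq E(G)$ be a matching whose edges are assigned arbitrary colours from $\mathcal{K}$. Then this precolouring can be extended to a proper edge-colouring of all of $G$ using only colours from $\mathcal{K}$.
   Context: A proper edge-colouring assigns colours to edges so that any two edges sharing an end-vertex receive distinct colours. Extending a precolouring means producing a proper edge-colouring of all of $G$ agreeing with the given colours on the precoloured edges. *)

(* Defs.v *)
From HB Require Import structures.
From mathcomp Require Import all_boot all_order all_algebra.
From mathcomp Require Import all_classical all_reals all_analysis.

Set Implicit Arguments.
Unset Strict Implicit.
Unset Printing Implicit Defensive.

Import Order.TTheory GRing.Theory Num.Theory.
Import numFieldNormedType.Exports.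

Record sgraph := SGraph {
  svertex :> finType;
  sedge : rel svertex;
  sedge_sym : symmetric sedge;
  sedge_irrefl : irreflexive sedge
}.

(* An edge is the two-element set of its ends. *)
Definition edges (G : sgraph) : {set {set G}} :=
  [set f : {set G} | [exists x, exists y, sedge x y && (f == [set x; y]%SET)]]%SET.

Definition degree (G : sgraph) (x : G) : nat := #|[set y | sedge x y]%SET|.

Definition max_degree (G : sgraph) : nat := \max_(x : G) degree x.

Definition matching (G : sgraph) (M : {set {set G}}) : Prop :=
  M \subset edges G /\
  {in M &, forall f g : {set G}, f != g -> [disjoint f & g]}.

(* Only the values of c on the edges of G matter. *)
Definition proper_edge_colouring (G : sgraph) (K : eqType)
    (c : {set G} -> K) : Prop :=
  {in edges G &, forall f g : {set G},
     f != g -> ~~ [disjoint f & g] -> c f != c g}.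

Definition simple_arc (R : realType) (A : set (R * R)%type)
    (a b : (R * R)%type) : Prop :=
  exists g : R -> (R * R)%type,
    [/\ {within `[0%R, 1%R], continuous g}%classic,
        {in `[0%R, 1%R]%R &, injective g},
        g 0%R = a, g 1%R = b & A = (g @` `[0%R, 1%R])%classic].

(* The vertices are distinct points p of the plane, each edge is a simple arc
   joining its ends and containing no other vertex, and two edges meet at
   common ends only. *)
Definition planar (R : realType) (G : sgraph) : Prop :=
  exists (p : G -> (R * R)%type) (A : {set G} -> set (R * R)%type),
  [/\ injective p,
      forall x y : G, sedge x y -> simple_arc (A [set x; y]%SET) (p x) (p y),
      {in edges G, forall f : {set G}, forall z : G, A f (p z) -> z \in f} &
      {in edges G &, forall f g : {set G}, f != g ->
         forall q, A f q -> A g q ->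
         exists z : G, [/\ z \in f, z \in g & q = p z]}].

(* Main.v *)
Require Import Defs.
From mathcomp Require Import all_boot all_order all_algebra.
From mathcomp Require Import all_classical all_reals all_analysis.
From mathcomp Require Import lra zify fintype finset.
From Stdlib Require Import Btauto.

(** Sparsity.  Arcs of vertex-disjoint edges are disjoint compact sets, so each
    arc can be replaced by a finite chain of points with tiny steps such that
    chains of disjoint edges stay far apart.  Graphs with such a drawing are
    closed under deletion and contraction, and [K5] has none: for disjoint edges
    the total turning of the difference vector around the boundary of the
    parameter rectangle vanishes mod 2, and the sum of these fifteen relations
    reads [0 = 1].  By Mader's theorem every subgraph has average degree below 6.

    Colouring.  Let [k] be the maximum degree, [d] the degree in a minimal
    uncolourable set [H] of edges outside [M], [m v] the number of [M]-edges at
    [v], and [r w = k - d w - m w].  An edge [uv] has a list of at least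
    [k + 1 - m u - m v] colours; hence [d u + m u + d v + m v >= k + 3].  If every
    edge [uw] with [u] in a set [X] of vertices of degree at most 5 satisfied
    [d u <= d_X w + r w], the edges at [X] could be coloured last by Galvin's
    argument.  So some [uw] violates this, and removing the neighbours of [w]
    from [X] repeatedly shows that at most [sum_w (t - 1 - r w)^+] vertices have
    degree at most [t], for [t <= 5].  Summing over [t], the excess
    [d w - 6 >= 10 - r w] of the large vertices pays for the deficit [6 - d v] of
    the small ones, contradicting sparsity. *)

Set Implicit Arguments.
Unset Strict Implicit.
Unset Printing Implicit Defensive.

Import Order.TTheory GRing.Theory Num.Theory.
Import numFieldNormedType.Exports.

(** * Chains of points in the plane *)

Section Chains.
Local Open Scope ring_scope.
Variable R : realFieldType.
Implicit Types (a b f g q u v w : R * R) (s t : seq (R * R)) (e d : R).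

Definition vsub a b : R * R := (a.1 - b.1, a.2 - b.2).

Definition near_pt e a b := (`|a.1 - b.1| < e) && (`|a.2 - b.2| < e).

Definition far_pt d a b := (d <= `|a.1 - b.1|) || (d <= `|a.2 - b.2|).

(* The tie-break on the axis makes [upper] change under [u -> - u] for all [u != 0]. *)
Definition upper u := (0 < u.2) || ((u.2 == 0) && (0 < u.1)).

(* For [u] and [v] close to each other and far from the origin, [cut u v] says
   that the step from [u] to [v] crosses the positive half-axis. *)
Definition cut u v := (upper u (+) upper v) && (0 < u.1).

Lemma upper_opp a b e : 0 < e -> far_pt e a b -> upper (vsub b a) = ~~ upper (vsub a b).
Proof.
move=> e0; rewrite /far_pt /upper /= -[b.2 - a.2]opprB -[b.1 - a.1]opprB !oppr_gt0 oppr_eq0.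
case: (ltrgtP (a.2 - b.2) 0) => //= ->; case: (ltrgtP (a.1 - b.1) 0) => //= ->.
by rewrite normr0 leNgt e0.
Qed.

Lemma upper_neq_small e u v : upper u != upper v -> `|u.2 - v.2| < e -> `|u.2| < e.
Proof.
rewrite /upper !ltr_norml => h /andP [h1 h2].
by move: h; case: (ltrgtP 0 u.2) => hu /=; case: (ltrgtP 0 v.2) => hv //=; lra.
Qed.

(** The change of [upper] puts [u] within [2 * e] of the horizontal axis, hence [w] within
    [4 * e < d] of it. Both are far from the origin, so their abscissae have modulus at least [d],
    and a step below [2 * e] cannot change the sign. *)
Lemma abscissa_sign e d u v w : 4 * e < d ->
  near_pt (2 * e) u v -> near_pt (2 * e) w u ->
  far_pt d u (0, 0) -> far_pt d w (0, 0) ->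
  upper u != upper v -> (0 < w.1) = (0 < u.1).
Proof.
move=> ed /andP [_ uv] /andP [wu1 wu2] /= fu fw huv.
have := upper_neq_small huv uv; move: wu1 wu2 fu fw.
rewrite /far_pt /= !subr0 !ltr_norml !ler_normr => /andP[? ?] /andP[? ?] h1 h2 /andP[? ?].
have {}h1 : (d <= u.1) || (d <= - u.1) by case/orP: h1 => // /orP; lra.
have {}h2 : (d <= w.1) || (d <= - w.1) by case/orP: h2 => // /orP; lra.
by case/orP: h1; case/orP: h2; case: (ltrP 0 w.1); case: (ltrP 0 u.1) => //; lra.
Qed.

Lemma far_vsub d a b : far_pt d (vsub a b) (0, 0) = far_pt d a b.
Proof. by rewrite /far_pt /= !subr0. Qed.

Lemma near_vsub2 e a b f g : near_pt e a b || (a == b) -> near_pt e f g || (f == g) ->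
  0 < e -> near_pt (2 * e) (vsub a f) (vsub b g).
Proof.
move=> h1 h2 e0; rewrite /near_pt /= !ltr_norml.
have {h1} : near_pt e a b by case/orP: h1 => [//|/eqP->]; rewrite /near_pt !subrr normr0 e0.
have {h2} : near_pt e f g by case/orP: h2 => [//|/eqP->]; rewrite /near_pt !subrr normr0 e0.
by rewrite /near_pt !ltr_norml; lra.
Qed.

Lemma near_pt_gt0 e a b : near_pt e a b -> 0 < e.
Proof. by case/andP=> h _; apply: le_lt_trans h. Qed.

Lemma near_pt_sym e a b : near_pt e a b = near_pt e b a.
Proof. by rewrite /near_pt distrC [`|a.2 - _|]distrC. Qed.

(** The boundary of a small cell does not wind around the origin. Either [upper] is constant on the
    four differences, or their abscissae all have one sign; then [cut] records either nothing or
    every change of [upper], and the changes around a closed cycle cancel mod 2. *)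
Lemma cut_cell e d a b f g : 4 * e < d -> near_pt e a b -> near_pt e f g ->
  far_pt d a f -> far_pt d b f -> far_pt d b g -> far_pt d a g ->
  cut (vsub a f) (vsub b f) (+) cut (vsub b f) (vsub b g) (+)
    cut (vsub a g) (vsub b g) (+) cut (vsub a f) (vsub a g) = false.
Proof.
move=> ed ab fg; rewrite -(far_vsub d a f) -(far_vsub d b f) -(far_vsub d b g) -(far_vsub d a g) => F1 F2 F3 F4.
have e0 := near_pt_gt0 ab.
have N x y z z' : x \in [:: a; b] -> y \in [:: a; b] -> z \in [:: f; g] -> z' \in [:: f; g] ->
    near_pt (2 * e) (vsub x z) (vsub y z').
  rewrite !inE => hx hy hz ht; apply: near_vsub2 => //.
    by case/orP: hx => /eqP->; case/orP: hy => /eqP->; rewrite ?eqxx ?orbT // ?ab // near_pt_sym ab.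
  by case/orP: hz => /eqP->; case/orP: ht => /eqP->; rewrite ?eqxx ?orbT // ?fg // near_pt_sym fg.
rewrite /cut.
have [|/allPn[v vin neq]] :=
    boolP (all (fun v => upper (vsub a f) == upper v) [:: vsub b f; vsub b g; vsub a g]).
  by case/and4P=> /eqP<- /eqP<- /eqP<- _; rewrite addbb.
have A w : near_pt (2 * e) w (vsub a f) -> far_pt d w (0, 0) -> (0 < w.1) = (0 < (vsub a f).1).
  move=> h1 h2; apply: (abscissa_sign ed _ h1 F1 h2 neq).
  by move: vin; rewrite !inE => /or3P[] /eqP->; apply: N; rewrite !inE eqxx ?orbT.
rewrite (A (vsub b f)) ?(A (vsub a g)) //; try by apply: N; rewrite !inE eqxx ?orbT.
by do 4!case: (upper _); case: (0 < _).
Qed.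

(** The parity of the crossings of the positive half-axis along the image of the chain under [h]: a
    winding number mod 2 when that image is closed. *)
Fixpoint turn (h : R * R -> R * R) a s :=
  if s is b :: s' then cut (h a) (h b) (+) turn h b s' else false.

(** Sum of [cut_cell] over the cells between [a] and [b]; each inner side belongs to two cells and
    cancels. *)
Lemma turn_strip e d a b f t : 4 * e < d -> near_pt e a b -> path (near_pt e) f t ->
  all (far_pt d a) (f :: t) -> all (far_pt d b) (f :: t) ->
  turn (vsub a) f t (+) turn (vsub b) f t
    = cut (vsub a f) (vsub b f) (+) cut (vsub a (last f t)) (vsub b (last f t)).
Proof.
move=> ed ab; elim: t f => [|g t IH] f /=; first by rewrite addbb.
move=> /andP[fg pt] /and3P[af ag at_] /and3P[bf bg bt].
have := IH g pt; rewrite /= ag at_ bg bt => /(_ isT isT) IH'.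
have := cut_cell ed ab fg af bf bg ag; move: IH'.
do 4!case: (cut _ _); do 2!case: (turn _ _ _); case: (cut _ _) => //=.
Qed.

(** Sum of [turn_strip] over the steps of [a :: s]: only the boundary of the parameter rectangle
    survives. *)
Lemma turn_square e d a s f t : 4 * e < d -> path (near_pt e) a s -> path (near_pt e) f t ->
  all (fun x => all (far_pt d x) (f :: t)) (a :: s) ->
  turn (vsub^~ f) a s (+) turn (vsub^~ (last f t)) a s
    = turn (vsub a) f t (+) turn (vsub (last a s)) f t.
Proof.
move=> ed ps pt; elim: s a ps => [|b s IH] a /=; first by rewrite addbb.
move=> /andP[ab pbs] /and3P[fa fb fs].
have := IH b pbs; rewrite /= fb fs => /(_ isT).
have := turn_strip ed ab pt fa fb.
do 2!case: (cut _ _); do 4!case: (turn _ _ _) => //=; by case: (turn _ _ _).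
Qed.

(** A change of [upper] happens at exactly one of the two half-axes, and negation exchanges these.
    So the two cuts differ exactly when [upper] changes. *)
Lemma cut_opp e d q a b : 4 * e < d -> near_pt e a b -> far_pt d a q -> far_pt d b q ->
  cut (vsub q a) (vsub q b) = cut (vsub a q) (vsub b q) (+) (upper (vsub a q) (+) upper (vsub b q)).
Proof.
move=> ed ab fa fb; have e0 := near_pt_gt0 ab; have d0 : 0 < d by lra.
rewrite /cut (upper_opp d0 fa) (upper_opp d0 fb).
case E : (upper (vsub a q) (+) upper (vsub b q)); last first.
  by move: E; case: (upper _); case: (upper _).
have neq : upper (vsub a q) != upper (vsub b q).
  by move: E; case: (upper _); case: (upper _).
have -> : ~~ upper (vsub a q) (+) ~~ upper (vsub b q) by move: E; case: (upper _); case: (upper _).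
have := @upper_neq_small e _ _ neq; case/andP: ab => _ /= ab2.
have -> : a.2 - q.2 - (b.2 - q.2) = a.2 - b.2 by lra.
move=> /(_ ab2); move: fa; rewrite /far_pt /= !ltr_norml !ler_normr.
by case: (ltrP 0 (a.1 - q.1)); case: (ltrP 0 (q.1 - a.1)) => //= ? ? /orP[/orP[]|/orP[]]; lra.
Qed.

Lemma turn_opp e d q a s : 4 * e < d -> path (near_pt e) a s -> all (far_pt d ^~ q) (a :: s) ->
  turn (vsub q) a s = turn (vsub^~ q) a s (+) (upper (vsub a q) (+) upper (vsub (last a s) q)).
Proof.
move=> ed; elim: s a => [|b s IH] a /=; first by rewrite addbb.
move=> /andP[ab pbs] /and3P[fa fb fs].
rewrite IH //= ?fb //= (cut_opp ed ab fa fb).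
by do 3!case: (upper _); case: (cut _ _); case: (turn _ _ _).
Qed.

Lemma addb_xorb x y : x (+) y = xorb x y.
Proof. by case: x; case: y. Qed.

Definition chain e a b s := path (near_pt e) a s /\ last a s = b.

Definition far_apart d s t := all (fun x => all (far_pt d x) t) s.

(** All four sides of the rectangle are brought to the form of a moving point minus a fixed end.
    Each term then depends on one edge and one vertex only, which lets terms cancel between
    different pairs of edges. *)
Lemma turn_sum e d a0 a1 s f0 f1 t : 4 * e < d -> chain e a0 a1 s -> chain e f0 f1 t ->
  far_apart d (a0 :: s) (f0 :: t) ->
  turn (vsub^~ f0) a0 s (+) turn (vsub^~ f1) a0 s (+) turn (vsub^~ a0) f0 t (+) turn (vsub^~ a1) f0 t
    = upper (vsub f0 a0) (+) upper (vsub f1 a0) (+) upper (vsub f0 a1) (+) upper (vsub f1 a1).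
Proof.
move=> ed [ps la] [pt lf] sep.
have far_sym x y : far_pt d x y = far_pt d y x by rewrite /far_pt distrC [`|x.2 - _|]distrC.
have fA q : q \in a0 :: s -> all (far_pt d ^~ q) (f0 :: t).
  by move=> /(allP sep) h; apply: sub_all h => z; rewrite far_sym.
have := turn_square ed ps pt sep; rewrite la lf.
rewrite (turn_opp ed pt (fA _ _)) ?mem_head // (turn_opp ed pt (fA _ _)) -?la ?mem_last // lf.
by do 4!case: (turn _ _ _); do 4!case: (upper _).
Qed.

Lemma no_separated_K5 (T : eqType) (p : T -> R * R) (P : T -> T -> seq (R * R)) e d (v : seq T) :
  0 < e -> 4 * e < d -> size v = 5 -> uniq v ->
  {in v &, forall x y, x != y -> chain e (p x) (p y) (P x y)} ->
  (forall x y z w : T, {subset [:: x; y; z; w] <= v} -> uniq [:: x; y; z; w] ->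
     far_apart d (p x :: P x y) (p z :: P z w)) ->
  False.
Proof.
move=> e0 ed sv uv ch sep.
have [x0 _] : exists x0, x0 \in v by case: v sv {uv ch sep} => // x v _; exists x; apply: mem_head.
pose X := nth x0 v; pose ok (I : seq nat) := uniq I && all (gtn 5) I.
(* The turning of the edge [i j] about the vertex [k]. Exactly two edges at [k] are disjoint from
   [i j], so this term enters two of the fifteen relations. *)
pose W i j k := turn (vsub^~ (p (X k))) (p (X i)) (P (X i) (X j)).
pose U i j := upper (vsub (p (X i)) (p (X j))).
have XP I : ok I -> uniq (map X I) /\ {subset map X I <= v}.
  case/andP=> uI /allP s5; rewrite map_inj_in_uniq // => [|i j /s5 /= hi /s5 /= hj /eqP].
    by split=> // _ /mapP[i /s5 hi ->]; apply: mem_nth; rewrite sv.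
  by rewrite nth_uniq ?sv // => /eqP.
have S i j k l : ok [:: i; j; k; l] ->
    W i j k (+) W i j l (+) W k l i (+) W k l j = U k i (+) U l i (+) U k j (+) U l j.
  case/XP=> us sub; have chX x y : x \in [:: X i; X j; X k; X l] -> y \in [:: X i; X j; X k; X l] ->
      x != y -> chain e (p x) (p y) (P x y) by move=> /sub ? /sub ?; apply: ch.
  apply: (turn_sum ed _ _ (sep _ _ _ _ sub us)); apply: chX;
    by move: us; rewrite /= !inE ?eqxx ?orbT // !negb_or => /and4P[/and3P[]].
have V i k j l : ok [:: i; j; k; l] -> U k i = ~~ U i k.
  case/XP=> us sub; have /= /andP[/andP[h _] _] := sep _ _ _ _ sub us.
  by apply: (@upper_opp _ _ d) h; lra.
have V01 := V 0 1 2 3 isT.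
have V02 := V 0 2 1 3 isT.
have V03 := V 0 3 1 2 isT.
have V04 := V 0 4 1 2 isT.
have V12 := V 1 2 0 3 isT.
have V13 := V 1 3 0 2 isT.
have V14 := V 1 4 0 2 isT.
have V23 := V 2 3 0 1 isT.
have V24 := V 2 4 0 1 isT.
have V34 := V 3 4 0 1 isT.
(* The sum of the relations [S] over the fifteen pairs of disjoint edges: every
   [W i j k] occurs twice, and the [U] terms add up to the parity of the number
   of crossing pairs of chords of a convex pentagon, which is odd. *)
have A (x y z w : bool) : x = y -> z = w -> x (+) z = y (+) w by move=> -> ->.
have := A _ _ _ _ (A _ _ _ _ (A _ _ _ _ (A _ _ _ _ (A _ _ _ _ (A _ _ _ _ (A _ _ _ _ (A _ _
  _ _ (A _ _ _ _ (A _ _ _ _ (A _ _ _ _ (A _ _ _ _ (A _ _ _ _ (A _ _ _ _ (S 0 1 2 3 isT) (S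
  0 1 2 4 isT)) (S 0 1 3 4 isT)) (S 0 2 1 3 isT)) (S 0 2 1 4 isT)) (S 0 2 3 4 isT)) (S 0 3
  1 2 isT)) (S 0 3 1 4 isT)) (S 0 3 2 4 isT)) (S 0 4 1 2 isT)) (S 0 4 1 3 isT)) (S 0 4 2 3
  isT)) (S 1 2 3 4 isT)) (S 1 3 2 4 isT)) (S 1 4 2 3 isT).
rewrite V01 V02 V03 V04 V12 V13 V14 V23 V24 V34 !addb_xorb.
set lhs := (Z in Z = _); set rhs := (Z in _ = Z).
suff -> : lhs = ~~ rhs by case: rhs.
by rewrite {}/lhs {}/rhs; clearbody W U; clear; btauto.
Qed.
End Chains.

(** * Edge bound for graph classes without a [K5] minor *)

Section Mader.
Variable T : finType.
Implicit Types (D : {set T * T}) (u v x y : T) (S : {set T}).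

Definition simple D := (forall x y, (x, y) \in D -> (y, x) \in D) /\ forall x, (x, x) \notin D.

Definition nbr D x := [set y | (x, y) \in D].

(** The vertex [v] is merged into [u] but stays in [T] as an isolated vertex, so that all minors
    live on the same type. *)
Definition contract_edge D u v := [set e : T * T | [&& e.1 != v, e.2 != v, e.1 != e.2 &
  [|| e \in D, (e.1 == u) && ((v, e.2) \in D) | (e.2 == u) && ((e.1, v) \in D)]]].

Lemma card_sum_nbr D : #|D| = \sum_x #|nbr D x|.
Proof.
rewrite -sum1_card; under [RHS]eq_bigr do rewrite -sum1_card.
rewrite pair_big_dep /=; apply: eq_bigl => -[x y] /=.
by rewrite inE.
Qed.

Lemma simple_sym D x y : simple D -> ((x, y) \in D) = ((y, x) \in D).
Proof. by case=> sym _; apply/idP/idP; apply: sym. Qed.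

Lemma simple_neq D x y : simple D -> (x, y) \in D -> x != y.
Proof. by case=> _ irr; apply: contraTneq => ->. Qed.

Lemma simple_contract D u v : simple D -> simple (contract_edge D u v).
Proof.
move=> sD; split=> [x y|x]; rewrite !inE /= ?eqxx ?andbF //.
case/and4P=> -> -> nxy; rewrite [y == x]eq_sym nxy /= => /or3P[h|/andP[-> h]|/andP[-> h]].
- by rewrite simple_sym // h.
- by rewrite (simple_sym y v) // h !orbT.
- by rewrite (simple_sym v x) // h !orbT.
Qed.

(** The contraction loses the edge itself and one edge for each common neighbour of [u] and [v],
    each counted in both directions. In terms of degrees, [h1] treats the two ends and [h2] the
    other vertices. *)
Lemma card_contract D u v : simple D -> (u, v) \in D ->
  #|D| <= #|contract_edge D u v| + 2 + 2 * #|nbr D u :&: nbr D v|.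
Proof.
move=> sD uvD; have nuv := simple_neq sD uvD; rewrite !card_sum_nbr.
set C := nbr D u :&: nbr D v; set D' := contract_edge D u v.
rewrite (bigD1 u) // (bigD1 v) 1?eq_sym //= [\sum_x #|nbr D' x|](bigD1 u) //=.
rewrite [\sum_(i | i != u) #|nbr D' i|](bigD1 v) 1?eq_sym //=.
have h1 : #|nbr D u| + #|nbr D v| <= #|nbr D' u| + 2 + #|C|.
  have := cardsUI (nbr D u :\ v) (nbr D v :\ u).
  have := cardsD1 v (nbr D u); have := cardsD1 u (nbr D v).
  rewrite !inE uvD -(simple_sym u) // uvD.
  have : #|(nbr D u :\ v) :&: (nbr D v :\ u)| <= #|C|.
    by apply/subset_leq_card/subsetP => x; rewrite !inE => /andP[/andP[_ ->] /andP[_ ->]].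
  have : #|(nbr D u :\ v) :|: (nbr D v :\ u)| <= #|nbr D' u|.
    apply/subset_leq_card/subsetP => x; rewrite !inE /= nuv eqxx /=.
    case/orP=> /andP[h1 h2].
      by rewrite h1 h2 (simple_neq sD).
    by rewrite [x == v]eq_sym (simple_neq sD h2) [u == x]eq_sym h1 h2 orbT.
  lia.
have h2 : \sum_(x | (x != u) && (x != v)) #|nbr D x| <=
          \sum_(x | (x != u) && (x != v)) #|nbr D' x| + #|C|.
  apply: (@leq_trans (\sum_(x | (x != u) && (x != v)) (#|nbr D' x| + (x \in C)))).
    apply: leq_sum => x /andP[xu xv].
    have sub : nbr D x :\ v \subset nbr D' x.
      apply/subsetP => y; rewrite !inE /= => /andP[yv h].
      by rewrite xv yv h (simple_neq sD).
    have := subset_leq_card sub; have := cardsD1 v (nbr D x); rewrite !inE.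
    rewrite (simple_sym u) // (simple_sym v) //.
    have [xvD|] := boolP ((x, v) \in D); last by lia.
    have [xuD|xuD] := boolP ((x, u) \in D); first by lia.
    have : u |: (nbr D x :\ v) \subset nbr D' x.
      rewrite subUset sub sub1set !inE /= xv nuv xu eqxx xvD !orbT.
      by [].
    by move/subset_leq_card; rewrite cardsU1 !inE (negPf xuD) andbF /=; lia.
  rewrite big_split /= leq_add2l big_mkcond /= -sum1_card [leqRHS]big_mkcond /=.
  by apply: leq_sum => x _; case: (_ && _); case: (_ \in _).
lia.
Qed.

Lemma pairwise_clique (E : rel T) (s : seq T) : symmetric E -> pairwise E s ->
  {in s &, forall x y, x != y -> E x y}.
Proof.
move=> symE; elim: s => [|z s IH] //= /andP[/allP az ps] x y.
rewrite !inE => /predU1P[->|xs] /predU1P[->|ys]; rewrite ?eqxx // => nxy.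
- exact: az.
- by rewrite symE; apply: az.
- exact: IH.
Qed.

Definition has_K5 D := exists2 s : seq T, size s = 5 /\ uniq s &
  {in s &, forall x y, x != y -> (x, y) \in D}.

Lemma pairwise_K5 D (s : seq T) : simple D -> size s = 5 -> uniq s ->
  pairwise (fun x y => (x, y) \in D) s -> has_K5 D.
Proof.
move=> sD s5 us ps; exists s => //; apply: pairwise_clique ps => x y.
exact: simple_sym.
Qed.

(** The link of [v] has at most 5 vertices and minimum degree at least 3. With 4 vertices it is
    complete. With 5 its complement is a matching, of at most two edges; contracting a link edge
    that meets all of these leaves a complete link on 4 vertices. *)
Lemma dense_link_K5 D v : simple D -> 0 < #|nbr D v| <= 5 ->
  {in nbr D v, forall y, 2 < #|nbr D v :&: nbr D y|} ->
  has_K5 D \/ exists x y, (x, y) \in D /\ has_K5 (contract_edge D x y).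
Proof.
move=> sD; pose E x y := (x, y) \in D.
have E0 x : E x x = false by apply/negbTE; case: sD => _; apply.
have symE x y : E x y = E y x by apply: simple_sym.
rewrite cardE; have : uniq (enum (nbr D v)) by apply: enum_uniq.
have Ns y : (y \in enum (nbr D v)) = E v y by rewrite mem_enum inE.
have Nc y : count (E y) (enum (nbr D v)) = #|nbr D v :&: nbr D y|.
  rewrite -size_filter cardE; apply/perm_size/uniq_perm.
  - exact/filter_uniq/enum_uniq.
  - exact: enum_uniq.
  by move=> z; rewrite mem_filter !mem_enum !inE andbC.
move=> us sz h; have {Nc} h y : y \in enum (nbr D v) -> 2 < count (E y) (enum (nbr D v)).
  by rewrite Nc mem_enum; apply: h.
have vs : all (E v) (enum (nbr D v)) by apply/allP => y; rewrite Ns.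
have vn : v \notin enum (nbr D v) by rewrite Ns E0.
move: (enum _) us sz h vs vn {Ns} => s us sz /allP h vs vn.
case: s us sz h vs vn => [|a [|b [|c [|d [|e [|? ?]]]]]] //=.
- by rewrite E0.
- by rewrite !E0; case: (E a b).
- by rewrite !E0; case: (E a b); case: (E a c).
- rewrite !E0 (symE b a) (symE c a) (symE d a) (symE c b) (symE d b) (symE d c).
  move=> us _ h vs vn; left; apply: (@pairwise_K5 D [:: v; a; b; c; d]) => //=.
    by rewrite vn.
  move: h vs; rewrite -!/(E _ _); do 4!case: (E v _) => //=.
  by do 6!case: (E _ _).
rewrite !E0 (symE b a) (symE c a) (symE d a) (symE e a) (symE c b) (symE d b) (symE e b)
  (symE d c) (symE e c) (symE e d).
move=> us _ h vs vn; right.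
have H x y p q r : perm_eq [:: x; y; p; q; r] [:: a; b; c; d; e] ->
   [&& E x y, E x p || E y p, E x q || E y q, E x r || E y r, E p q, E p r & E q r] ->
   exists x y, (x, y) \in D /\ has_K5 (contract_edge D x y).
  move=> pm /and5P[Exy Exp Exq Exr /and3P[Epq Epr Eqr]]; exists x, y; split=> //.
  have vs' : all (E v) [:: x; y; p; q; r] by rewrite (perm_all _ pm) /= vs.
  have us' : uniq [:: x; y; p; q; r] by rewrite (perm_uniq pm).
  have vn' : v \notin [:: x; y; p; q; r] by rewrite (perm_mem pm).
  apply: (@pairwise_K5 _ [:: v; x; p; q; r]) => //; first exact: simple_contract.
    move: us' vn'; rewrite /= !inE !negb_or.
    by case/and5P=> /and4P[_ -> -> ->] _ /andP[-> ->] -> _ /and5P[-> _ -> -> ->].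
  move: us' vn' vs'; rewrite /= !inE !negb_or /= -!/(E _ _) ![_ == y]eq_sym.
  case/and5P=> /and4P[xy -> -> ->] /and3P[-> -> ->] /andP[-> ->] -> _.
  case/and5P=> -> vy -> -> -> /and5P[-> _ -> -> /andP[-> _]].
  rewrite vy xy eqxx Epq Epr Eqr /=.
  by rewrite !orbA Exp Exq Exr.
move: H; set G := (exists x y, _) => H.
(* All ten candidates for the contracted edge are listed; the adjacency patterns of the five
   neighbours are then checked exhaustively. *)
have Hab := H a b c d e ltac:(by apply/permP => k /=; clear; lia).
have Hac := H a c b d e ltac:(by apply/permP => k /=; clear; lia).
have Had := H a d b c e ltac:(by apply/permP => k /=; clear; lia).
have Hae := H a e b c d ltac:(by apply/permP => k /=; clear; lia).
have Hbc := H b c a d e ltac:(by apply/permP => k /=; clear; lia).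
have Hbd := H b d a c e ltac:(by apply/permP => k /=; clear; lia).
have Hbe := H b e a c d ltac:(by apply/permP => k /=; clear; lia).
have Hcd := H c d a b e ltac:(by apply/permP => k /=; clear; lia).
have Hce := H c e a b d ltac:(by apply/permP => k /=; clear; lia).
have Hde := H d e a b c ltac:(by apply/permP => k /=; clear; lia).
rewrite !(symE b a, symE c a, symE d a, symE e a, symE c b, symE d b, symE e b, symE d c, symE e c, symE e d)
  in Hac Had Hae Hbc Hbd Hbe Hcd Hce Hde.
move: h Hab Hac Had Hae Hbc Hbd Hbe Hcd Hce Hde; clearbody G.
move: (E a b) (E a c) (E a d) (E a e) (E b c) (E b d) (E b e) (E c d) (E c e) (E d e); clear.
by do 10!case; move=> // _; do ?[move/(_ isT) => g; done | move=> _].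
Qed.

Lemma simple_del D x y : simple D -> simple (D :\: [set (x, y); (y, x)]).
Proof.
move=> sD; split=> [z t|z]; last by rewrite inE (negPf (proj2 sD z)) andbF.
rewrite !inE !xpair_eqE !negb_or !negb_and => /andP[/andP[h1 h2] h].
by rewrite simple_sym // h andbT orbC h2 orbC h1.
Qed.

(* Mader's theorem on [K5] minors; [D] contains every edge in both directions. *)
Lemma minor_closed_card (Q : {set T * T} -> Prop) :
  (forall D D', D' \subset D -> Q D -> Q D') ->
  (forall D u v, simple D -> (u, v) \in D -> Q D -> Q (contract_edge D u v)) ->
  (forall D, simple D -> Q D -> ~ has_K5 D) ->
  forall D S, simple D -> Q D -> D \subset setX S S -> 2 < #|S| -> #|D| + 12 <= 6 * #|S|.
Proof.
move=> Qsub Qcon QK5 D S; have [n] := ubnP #|S|; elim: n S D => // n IHS S D.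
have [m] := ubnP #|D|; elim: m D => // m IHD D Dm Sn sD QD DS S3.
have [//|big] := leqP; exfalso.
have DS' x y : (x, y) \in D -> x \in S /\ y \in S.
  by move/(subsetP DS); rewrite inE => /andP.
have irrD : D \subset setX S S :\: [set e | e.1 == e.2].
  apply/subsetP => -[x y] xyD; rewrite inE (subsetP DS) // andbT inE /=.
  exact: simple_neq xyD.
have Ssq : #|D| + #|S| <= #|S| * #|S|.
  have diag : setX S S :&: [set e | e.1 == e.2] = [set (x, x) | x in S].
    apply/setP=> -[x y]; rewrite !inE /=; apply/andP/imsetP.
      by case=> /andP[xS _] /eqP <-; exists x.
    by case=> z zS [-> ->]; rewrite zS.
  have := cardsID [set e | e.1 == e.2] (setX S S); rewrite cardsX diag.
  rewrite card_imset; last by move=> x y [].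
  by move=> <-; rewrite addnC leq_add2l; apply: subset_leq_card irrD.
(* Three vertices carry at most [6 = 6 * 3 - 12] darts, so the bound holds there, and removing a
   vertex from [S] will leave at least three. *)
have S4 : 3 < #|S| by rewrite ltn_neqAle S3 andbT; apply/eqP => h; rewrite -h in Ssq big; lia.
(* Above this threshold one edge, that is two elements of [D], can be deleted and the bound still
   fails. Below it the average degree is under 6, which yields the vertex [v]. *)
have [le|gt] := leqP #|D| (6 * #|S| - 10); last first.
  have /card_gt0P[[x y] xyD] : 0 < #|D| by lia.
  have yxD : (y, x) \in D by case: sD => sym _; apply: sym.
  have c2 : #|[set (x, y); (y, x)]| = 2.
    by rewrite cards2 xpair_eqE negb_and (simple_neq sD xyD).
  have cD : #|D :\: [set (x, y); (y, x)]| + 2 = #|D|.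
    have := cardsID [set (x, y); (y, x)] D; rewrite (setIidPr _) ?c2; first by rewrite addnC.
    by apply/subsetP => e; rewrite !inE => /orP[] /eqP->.
  move: cD (simple_del x y sD) (Qsub _ _ (subsetDl D [set (x, y); (y, x)]) QD)
    (subset_trans (subsetDl D [set (x, y); (y, x)]) DS).
  move: (D :\: _) => D' cD sD' QD' DS''; have D'm : #|D'| < m by lia.
  by have := IHD D' D'm Sn sD' QD' DS'' S3; lia.
have [v vS dv] : exists2 v, v \in S & #|nbr D v| <= 5.
  have [/exists_inP[v ? ?]|] := boolP [exists v in S, #|nbr D v| <= 5]; first by exists v.
  rewrite negb_exists_in => /forall_inP h.
  have : \sum_(v in S) 6 <= \sum_(v in S) #|nbr D v|.
    by apply: leq_sum => v /h; rewrite -ltnNge.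
  have : \sum_(v in S) #|nbr D v| <= #|D|.
    by rewrite card_sum_nbr [leqRHS](bigID (mem S)) leq_addr.
  by rewrite sum_nat_const; lia.
have cS : #|S :\ v|.+1 = #|S| by rewrite (cardsD1 v S) vS.
have [d0|dpos] := posnP #|nbr D v|.
  have DSv : D \subset setX (S :\ v) (S :\ v).
    apply/subsetP => -[x y] xyD; have [xS yS] := DS' _ _ xyD; rewrite !inE /= xS yS !andbT.
    have n0 z : (v, z) \notin D by have /eqP := d0; rewrite cards_eq0 => /eqP/setP/(_ z); rewrite !inE => ->.
    apply/andP; split; first by apply: contraTneq xyD => ->.
    by rewrite (simple_sym x y sD) in xyD; apply: contraTneq xyD => ->.
  have [Svn Sv3] : #|S :\ v| < n /\ 2 < #|S :\ v| by lia.
  by have := IHS _ _ Svn sD QD DSv Sv3; lia.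
have [/forall_inP h|] := boolP [forall y in nbr D v, 2 < #|nbr D v :&: nbr D y|].
  have dv' : 0 < #|nbr D v| <= 5 by rewrite dpos.
  have [|[x [y [xyD]]]] := dense_link_K5 sD dv' h; first exact: QK5.
  by apply: QK5; [apply: simple_contract | apply: Qcon].
(* An edge [v y] with at most two common neighbours: contracting it costs at most [2 + 2 * 2 = 6]
   elements of [D] and one vertex, in accordance with the slope of the bound. *)
rewrite negb_forall_in => /exists_inP[y]; rewrite inE -leqNgt => vyD cy.
have yvD : (y, v) \in D by case: sD => sym _; apply: sym.
have cc := card_contract sD yvD; rewrite setIC in cc.
have DSv : contract_edge D y v \subset setX (S :\ v) (S :\ v).
  have [yS _] := DS' _ _ yvD.
  apply/subsetP => -[p q]; rewrite !inE /= => /and4P[-> -> _].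
  by case/or3P=> [/DS'[-> ->]|/andP[/eqP-> /DS'[_ ->]]|/andP[/eqP-> /DS'[->]]]; rewrite ?yS.
have [Svn Sv3] : #|S :\ v| < n /\ 2 < #|S :\ v| by lia.
have := IHS _ _ Svn (simple_contract y v sD) (Qcon _ _ _ sD yvD QD) DSv Sv3.
move: cc cy; rewrite -cS in big *; move: #|_| #|_| #|_| #|_| big; lia.
Qed.

Lemma minor_closed_average (Q : {set T * T} -> Prop) :
  (forall D D', D' \subset D -> Q D -> Q D') ->
  (forall D u v, simple D -> (u, v) \in D -> Q D -> Q (contract_edge D u v)) ->
  (forall D, simple D -> Q D -> ~ has_K5 D) ->
  forall D S, simple D -> Q D -> D \subset setX S S -> 0 < #|S| -> #|D| < 6 * #|S|.
Proof.
move=> Qsub Qcon QK5 D S sD QD DS S0; have [S3|] := ltnP 2 #|S|.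
  by have := minor_closed_card Qsub Qcon QK5 sD QD DS S3; lia.
by move=> S2; have := subset_leq_card DS; rewrite cardsX; nia.
Qed.

End Mader.

(** * Discretised drawings *)

Section Drawings.
Variables (R : realFieldType) (T : finType) (p : T -> R * R) (e d : R).
Hypotheses (e_gt0 : (0 < e)%R) (e_small : (4 * e < d)%R).

(** Only edges without a common end are kept apart, which is what contraction preserves. The chains
    for [(x, y)] and [(y, x)] need not be related. *)
Definition drawable (D : {set T * T}) := exists P : T -> T -> seq (R * R),
  (forall x y, (x, y) \in D -> chain e (p x) (p y) (P x y)) /\
  (forall x y z w, (x, y) \in D -> (z, w) \in D -> uniq [:: x; y; z; w] ->
     far_apart d (p x :: P x y) (p z :: P z w)).

Lemma drawable_sub (D D' : {set T * T}) : D' \subset D -> drawable D -> drawable D'.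
Proof.
move=> /subsetP sub [P [ch sep]]; exists P; split=> [x y /sub|x y z w /sub h /sub]; first exact: ch.
exact: sep.
Qed.

Lemma chain_cat (a b c : R * R) s t : chain e a b s -> chain e b c t -> chain e a c (s ++ t).
Proof. by move=> [p1 l1] [p2 l2]; split; rewrite ?cat_path ?p1 ?last_cat l1. Qed.

Lemma far_apart_sym (s t : seq (R * R)) : far_apart d s t = far_apart d t s.
Proof.
have far_sym x y : far_pt d x y = far_pt d y x by rewrite /far_pt distrC [`|x.2 - _|%R]distrC.
by apply/allP/allP => h x xs; apply/allP => y ys; rewrite far_sym; move/allP: (h y ys); apply.
Qed.

Lemma far_apart_cat (a b : R * R) s t r : far_apart d (a :: s) r -> far_apart d (b :: t) r ->
  far_apart d (a :: s ++ t) r.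
Proof. by rewrite /far_apart /= all_cat => /andP[-> ->] /andP[_ ->]. Qed.

(** A new edge at [u] is drawn through [v] by concatenating two old chains. Both are far from any
    old edge that avoids [u], [v] and the other end; two new edges share [u], so nothing is required
    of them. *)
Lemma drawable_contract (D : {set T * T}) u v :
  simple D -> (u, v) \in D -> drawable D -> drawable (contract_edge D u v).
Proof.
move=> sD uvD [P [ch sep]].
have vuD : (v, u) \in D by case: sD => sym _; apply: sym.
pose P' x y := if (x, y) \in D then P x y else
  if x == u then P u v ++ P v y else P x v ++ P v u.
have P'far x y z w : (x, y) \in contract_edge D u v -> (x, y) \notin D -> (z, w) \in D ->
    z != v -> w != v -> uniq [:: x; y; z; w] -> far_apart d (p x :: P' x y) (p z :: P z w).
  rewrite inE /P' => + xyD; rewrite (negPf xyD) /= => /and4P[xv yv nxy cases] zwD zv wv.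
  rewrite !inE !negb_or andbT => /and3P[/and3P[_ xz xw] /andP[yz yw] zw].
  case/orP: cases => [/andP[/eqP xu h]|/andP[/eqP yu h]].
    by subst x; rewrite eqxx; apply: (@far_apart_cat _ (p v)); apply: sep => //=;
      rewrite !inE !negb_or ?xv ?xz ?xw ?yz ?yw ?zw ?[v == _]eq_sym ?yv ?zv ?wv.
  subst y; rewrite (negPf nxy); apply: (@far_apart_cat _ (p v)); apply: sep => //=;
    by rewrite !inE !negb_or ?xv ?xz ?xw ?yz ?yw ?zw ?[v == _]eq_sym ?yv ?zv ?wv.
have inD x y : (x, y) \in contract_edge D u v -> (x, y) \notin D -> (u == x) || (u == y).
  rewrite inE /= => /and4P[_ _ _ h] /negPf xyD; move: h; rewrite xyD /=.
  by case/orP => /andP[/eqP-> _]; rewrite eqxx ?orbT.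
exists P'; split=> [x y|x y z w xyD' zwD' uq].
  rewrite inE /P' /= => /and4P[_ _ nxy /or3P[h|/andP[/eqP-> h]|/andP[/eqP yu h]]].
  - by rewrite h; apply: ch.
  - by case: ifP => [/ch //|_]; rewrite eqxx; apply: chain_cat; apply: ch.
  - subst y; case: ifP => [/ch //|_]; rewrite (negPf nxy).
    by apply: chain_cat; apply: ch.
have vD' x' y' : (x', y') \in contract_edge D u v -> x' != v /\ y' != v.
  by rewrite inE => /and4P[].
have [xv yv] := vD' _ _ xyD'; have [zv wv] := vD' _ _ zwD'.
have [xyD|xyD] := boolP ((x, y) \in D); have [zwD|zwD] := boolP ((z, w) \in D).
- by rewrite /P' xyD zwD; apply: sep.
- rewrite far_apart_sym {2}/P' xyD; apply: P'far => //.
  by rewrite -[_ :: _]/([:: z; w] ++ [:: x; y]) uniq_catC.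
- by rewrite {2}/P' zwD; apply: P'far.
- exfalso; move: (inD _ _ xyD' xyD) (inD _ _ zwD' zwD) uq; rewrite /= !inE.
  by do 2!case/orP=> /eqP <-; rewrite eqxx ?orbT ?andbF.
Qed.

Lemma drawable_no_K5 (D : {set T * T}) : simple D -> drawable D -> ~ has_K5 D.
Proof.
move=> sD [P [ch sep]] [s [s5 us] cl].
apply: (@no_separated_K5 R T p P e d s) => // [x y xs ys nxy|x y z w sub uq].
  by apply: ch; apply: cl.
apply: (sep) => //; apply: cl; try by apply: sub; rewrite !inE eqxx ?orbT.
all: by move: uq; rewrite /= !inE !negb_or => /and4P[/and3P[]].
Qed.

Lemma drawable_average (D : {set T * T}) (S : {set T}) : simple D -> drawable D ->
  D \subset setX S S -> 0 < #|S| -> #|D| < 6 * #|S|.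
Proof.
apply: minor_closed_average; [exact: drawable_sub | exact: drawable_contract | exact: drawable_no_K5].
Qed.
End Drawings.

(** * From drawings by arcs to drawings by chains *)

Section Discretisation.
Variable R : realType.
Local Open Scope classical_set_scope.
Local Open Scope ring_scope.

Lemma near_ptE (e : R) (a b : R * R) : near_pt e a b <-> ball a e b.
Proof. by rewrite /near_pt; split=> [/andP[h1 h2]|[h1 h2]]; [split | apply/andP; split]. Qed.

(** The points of [A] reachable from [a] by such chains form a nonempty set that is open and closed
    relative to [A], because points of [A] within [e] of each other are reachable together. *)
Lemma connected_chain (A : set (R * R)) a b (e : R) : 0 < e -> connected A -> A a -> A b ->
  exists s, chain e a b s /\ {in s, forall q, A q}.
Proof.
move=> e0 cA Aa Ab.
pose B := [set q | A q /\ exists s, chain e a q s /\ {in s, forall q, A q}].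
have step q r : B q -> A r -> near_pt e q r -> B r.
  move=> [Aq [s [[ps ls] As]]] Ar qr; split=> //; exists (rcons s r); split.
    by split; rewrite ?last_rcons // rcons_path ps ls.
  by move=> z; rewrite mem_rcons inE => /predU1P[->|/As].
suff BA : B = A by have [_] : B b by rewrite BA.
apply: cA.
- by exists a; split=> //; exists [::].
- exists (\bigcup_(q in B) ball q e); first by apply: bigcup_open => q _; exact: ball_open.
  apply/seteqP; split=> [q Bq|q [Aq [r Br /near_ptE]]].
    by split; [case: Bq | exists q => //; exact: ballxx].
  exact: step.
- exists (~` \bigcup_(q in A `\` B) ball q e).
    by apply: open_closedC; apply: bigcup_open => q _; exact: ball_open.
  apply/seteqP; split=> [q Bq|q [Aq nq]].
    split; first by case: Bq.
    by move=> [r [Ar nBr] /near_ptE qr]; apply: nBr; apply: (step q) => //; rewrite near_pt_sym.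
  by apply: contrapT => nBq; apply: nq; exists q => //; exact: ballxx.
Qed.

(** The distances between points of [A] and [B] form a compact, hence closed, set missing 0; the
    radius of a ball around 0 that avoids it serves as [d]. *)
Lemma compact_separation (A B : set (R * R)) : compact A -> compact B -> (forall q, A q -> ~ B q) ->
  exists2 d : R, 0 < d & forall a b, A a -> B b -> far_pt d a b.
Proof.
move=> cA cB AB; pose h (z : (R * R) * (R * R)) : R := `|z.1 - z.2|.
have ch : continuous h.
  by move=> z; apply: cvg_norm; apply: cvgB; [exact: cvg_fst | exact: cvg_snd].
have cK : compact (h @` (A `*` B)).
  by apply: continuous_compact; [exact: continuous_subspaceT | exact: compact_setX].
have clK : closed (h @` (A `*` B)) by apply: compact_closed cK; exact: norm_hausdorff.
have K0 : nbhs (0 : R) (~` (h @` (A `*` B))).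
  apply: open_nbhs_nbhs; split; first exact: closed_openC.
  move=> [[a b] [/= Aa Bb] /eqP]; rewrite normr_eq0 subr_eq0 => /eqP /= ab.
  by apply: (AB a) => //; rewrite ab.
have /nbhs_ballP[d /= d0 sub] := K0.
exists d => // a b Aa Bb; rewrite /far_pt -le_max; have := sub (h (a, b)).
rewrite /ball /= sub0r normrN /h /= normr_id leNgt => nK; apply/negP => lt.
by apply: nK => //; exists (a, b).
Qed.

Lemma finite_common_bound (I : finType) (P : I -> R -> Prop) :
  (forall i x y, P i y -> x <= y -> P i x) -> (forall i, exists2 x, 0 < x & P i x) ->
  exists2 x, 0 < x & forall i, P i x.
Proof.
move=> mono ex; suff [x x0 h] : exists2 x, 0 < x & {in enum I, forall i, P i x}.
  by exists x => // i; apply: h; rewrite mem_enum.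
elim: (enum I) => [|i s [x x0 h]]; first by exists 1.
have [y y0 Py] := ex i; exists (Num.min x y); first by rewrite lt_min x0.
move=> j; rewrite inE => /predU1P[->|/h Pj]; [apply: mono Py _ | apply: mono Pj _].
  by rewrite ge_min lexx orbT.
by rewrite ge_min lexx.
Qed.

Lemma simple_arc_compact (A : set (R * R)) a b : simple_arc A a b -> compact A.
Proof.
by case=> g [cg _ _ _ ->]; apply: continuous_compact => //; exact: segment_compact.
Qed.

Lemma simple_arc_connected (A : set (R * R)) a b : simple_arc A a b -> connected A.
Proof.
by case=> g [cg _ _ _ ->]; apply: connected_continuous_connected => //; exact: segment_connected.
Qed.

Lemma simple_arc_ends (A : set (R * R)) a b : simple_arc A a b -> A a /\ A b.
Proof.
by case=> g [_ _ <- <- ->]; split; [exists 0 | exists 1] => //=; rewrite in_itv /= lexx ler01.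
Qed.

Lemma planar_drawable (G : sgraph) : planar R G ->
  exists (p : G -> R * R) (e d : R), [/\ 0 < e, 4 * e < d &
    drawable p e d [set xy : G * G | sedge xy.1 xy.2]%SET].
Proof.
move=> [p [A [injp arc _ meet]]].
pose far_edges (z : (G * G) * (G * G)) (d : R) :=
  sedge z.1.1 z.1.2 -> sedge z.2.1 z.2.2 -> uniq [:: z.1.1; z.1.2; z.2.1; z.2.2] ->
  forall a b, A [set z.1.1; z.1.2]%SET a -> A [set z.2.1; z.2.2]%SET b -> far_pt d a b.
have [||d d0 far] := @finite_common_bound _ far_edges.
- move=> z x y h xy e1 e2 u a b Aa Ab; have := h e1 e2 u a b Aa Ab.
  by case/orP=> h'; rewrite /far_pt (le_trans xy h') ?orbT.
- move=> [[x y] [z w]]; rewrite /far_edges /=.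
  have [e1|] := boolP (sedge x y); last by move=> /negP n; exists 1 => // *; case: n.
  have [e2|] := boolP (sedge z w); last by move=> /negP n; exists 1 => // *; case: n.
  have [u|] := boolP (uniq [:: x; y; z; w]); last by move=> /negP n; exists 1 => // *; case: n.
  have [|d d0 far] := compact_separation (simple_arc_compact (arc _ _ e1))
    (simple_arc_compact (arc _ _ e2)); last by exists d => // _ _ _; exact: far.
  have inE1 x' y' : sedge x' y' -> [set x'; y']%SET \in edges G.
    by move=> h; rewrite inE; apply/existsP; exists x'; apply/existsP; exists y'; rewrite h eqxx.
  move=> q q1 q2.
  have nfg : ([set x; y] != [set z; w])%SET.
    apply/eqP => /setP/(_ x); rewrite !inE eqxx /=.
    by move: u; rewrite /= !inE !negb_or => /and4P[/and3P[_ /negPf-> /negPf->]].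
  have [t [tf tg _]] := meet _ _ (inE1 _ _ e1) (inE1 _ _ e2) nfg q q1 q2.
  move: tf tg u; rewrite /= !inE.
  by do 2!case/orP => /eqP->; rewrite eqxx ?orbT ?andbF.
(* Any step below [d / 4] would serve. *)
have e0 : 0 < d / 5 by rewrite divr_gt0.
have /choice[P HP] : forall xy : G * G, exists s : seq (R * R), sedge xy.1 xy.2 ->
    chain (d / 5) (p xy.1) (p xy.2) s /\ {in s, forall q, A [set xy.1; xy.2]%SET q}.
  move=> [x y] /=; have [e1|] := boolP (sedge x y); last by move=> /negP n; exists [::] => e1; case: n.
  have [a1 a2] := simple_arc_ends (arc _ _ e1).
  have [s hs] := connected_chain e0 (simple_arc_connected (arc _ _ e1)) a1 a2.
  by exists s.
exists p, (d / 5), d; split=> //; first by lra.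
exists (fun x y => P (x, y)); split=> [x y|x y z w]; rewrite !inE => e1.
  by have [] := HP (x, y) e1.
move=> e2 u; apply/allP => a aP; apply/allP => b bP.
apply: (far ((x, y), (z, w))) => //=.
  move: aP; rewrite inE => /predU1P[->|aP]; first by have [] := simple_arc_ends (arc _ _ e1).
  by have [_] := HP (x, y) e1; apply.
move: bP; rewrite inE => /predU1P[->|bP]; first by have [] := simple_arc_ends (arc _ _ e2).
by have [_] := HP (z, w) e2; apply.
Qed.
End Discretisation.

(** * List colourings of bipartite graphs *)

Lemma free_colour (I : finType) (A : {set I}) (c : I -> nat) q : #|A| < q ->
  exists2 a, a < q & {in A, forall x, c x != a}.
Proof.
move=> Aq; have [/allP sub|/allPn[a]] := boolP (all (mem (map c (enum A))) (iota 0 q)).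
  have := uniq_leq_size (iota_uniq 0 q) sub.
  by rewrite size_iota size_map -cardE leqNgt Aq.
rewrite mem_iota /= => aq aA; exists a => // x xA.
by apply: contraNneq aA => <-; apply: map_f; rewrite mem_enum.
Qed.

Lemma card_le_range (I : finType) (A : {set I}) (c : I -> nat) a n :
  {in A &, injective c} -> {in A, forall x, a <= c x < a + n} -> #|A| <= n.
Proof.
move=> injc rng; have uq : uniq (map c (enum A)).
  rewrite map_inj_in_uniq ?enum_uniq // => x y.
  by rewrite !mem_enum; apply: injc.
have := @uniq_leq_size _ _ (iota a n) uq; rewrite size_map -cardE size_iota; apply.
by move=> y /mapP[x]; rewrite mem_enum => /rng h ->; rewrite mem_iota.
Qed.

Section BipartiteColouring.
Variables U W : finType.
Implicit Types (F S : {set U * W}) (e f g : U * W).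

Definition ldeg F u := #|[set e in F | e.1 == u]|.
Definition rdeg F w := #|[set e in F | e.2 == w]|.

Definition adjacent e f := (e != f) && ((e.1 == f.1) || (e.2 == f.2)).

Definition proper_on (K : eqType) F (c : U * W -> K) :=
  {in F &, forall e f, adjacent e f -> c e != c f}.

Lemma adjacent_sym e f : adjacent e f = adjacent f e.
Proof. by rewrite /adjacent eq_sym (eq_sym e.1) (eq_sym e.2). Qed.

Lemma proper_on_sub (K : eqType) F S (c : U * W -> K) :
  S \subset F -> proper_on F c -> proper_on S c.
Proof. by move=> /subsetP sub pc e f /sub eF /sub fF; apply: pc. Qed.

Lemma proper_on_inj (K : eqType) F (c : U * W -> K) e f : proper_on F c -> e \in F -> f \in F ->
  (e.1 == f.1) || (e.2 == f.2) -> c e = c f -> e = f.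
Proof.
move=> pc eF fF adj cef; apply: contraTeq isT => nef.
by have := pc e f eF fF; rewrite /adjacent nef adj cef eqxx => /(_ isT).
Qed.

(* Adding an edge [(u, w)] with [q w] minimal, the colours below [q w] are legal
   on all other edges, so that Kempe exchanges remain possible. *)
Lemma konig_extend F (q : W -> nat) (c : U * W -> nat) u w :
  (u, w) \in F -> {in F, forall e, q w <= q e.2} ->
  ldeg F u <= q w -> rdeg F w <= q w ->
  proper_on (F :\ (u, w)) c -> {in F :\ (u, w), forall e, c e < q e.2} ->
  exists c' : U * W -> nat, proper_on F c' /\ {in F, forall e, c' e < q e.2}.
Proof.
set F' := F :\ (u, w) => uwF qmin du dw pc cq.
have [a aq aw] : exists2 a, a < q w & {in F', forall e, e.2 = w -> c e != a}.
  have [|a aq h] := @free_colour _ [set e in F' | e.2 == w] c (q w).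
    apply: leq_trans dw; apply: proper_card; apply/properP; split.
      by apply/subsetP => e; rewrite !inE -andbA => /and3P[_ -> ->].
    by exists (u, w); rewrite !inE ?uwF eqxx.
  by exists a => // e eF ew; apply: h; rewrite inE eF ew /=.
have [b bq bu] : exists2 b, b < q w & {in F', forall e, e.1 = u -> c e != b}.
  have [|b bq h] := @free_colour _ [set e in F' | e.1 == u] c (q w).
    apply: leq_trans du; apply: proper_card; apply/properP; split.
      by apply/subsetP => e; rewrite !inE -andbA => /and3P[_ -> ->].
    by exists (u, w); rewrite !inE ?uwF eqxx.
  by exists b => // e eF eu; apply: h; rewrite inE eF eu /=.
(* One double step of the Kempe chain between left vertices: along an edge coloured [a], then back
   along one coloured [b]. Colours are exchanged on all edges whose left end is reachable from
   [u]. *)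
pose r x y := [exists v, [&& (x, v) \in F', (y, v) \in F', c (x, v) == a & c (y, v) == b]].
pose sw k := if k == a then b else if k == b then a else k.
have swI : injective sw.
  move=> k l; rewrite /sw; case: (eqVneq k a) => ?; case: (eqVneq l a) => ?;
    case: (eqVneq k b) => ?; case: (eqVneq l b) => ?; lia.
have swa k : sw k = a -> k = b.
  by rewrite /sw; case: (eqVneq k a) => ?; case: (eqVneq k b) => ?; lia.
pose c' e := if e == (u, w) then a else if connect r u e.1 then sw (c e) else c e.
(* Since [b] is free at [u], an edge coloured [b] at a reachable vertex is the one through which the
   chain arrived, so an edge coloured [a] precedes it. *)
have pred x v : connect r u x -> (x, v) \in F' -> c (x, v) = b ->
    exists y, [/\ connect r u y, (y, v) \in F' & c (y, v) = a].
  case/connectP=> p; case: p / lastP => [|p y] /= => [_ -> xF /eqP|]; first by rewrite (negPf (bu _ xF _)).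
  rewrite rcons_path last_rcons => /andP[pp /existsP[v' /and4P[h1 h2 /eqP h3 /eqP h4]]] xy xF cx.
  subst y; have [] : (x, v') = (x, v).
    by apply: (proper_on_inj pc) => //=; rewrite ?eqxx // h4.
  move=> vv; subst v'; exists (last u p); split => //.
  by apply/connectP; exists p.
have mix e f : e \in F' -> f \in F' -> connect r u e.1 -> ~~ connect r u f.1 ->
    e.2 = f.2 -> sw (c e) != c f.
  case: e f => [x v] [y v'] /= eF fF ux uy vv; subst v'.
  rewrite /sw; case: (c (x, v) =P a) => [ca|_].
    apply: contra uy => /eqP cb; apply: connect_trans ux (connect1 _).
    by apply/existsP; exists v; rewrite eF fF ca -cb !eqxx.
  case: (c (x, v) =P b) => [cb|_].
    have [z [uz zF ca]] := pred _ _ ux eF cb.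
    apply: contra uy => /eqP ca'; suff [<-] : (z, v) = (y, v) by [].
    by apply: (proper_on_inj pc) => //=; rewrite ?eqxx ?orbT // ca.
  apply: pc => //; rewrite /adjacent /= eqxx orbT andbT.
  by apply: contraNneq uy => -[<-].
(* After the exchange [a] is free at [u], where [b] was. It stays free at [w]: a recoloured edge
   there would, by [pred], need an edge coloured [a] at [w]. *)
have new f : f \in F' -> adjacent (u, w) f -> a != c' f.
  case: f => [y v] fF; rewrite /adjacent /c' /= => /andP[nf adj].
  rewrite [(y, v) == _]eq_sym (negPf nf); case: ifP => uy.
    rewrite eq_sym; apply/eqP => /swa cb; case/orP: adj => /eqP h.
      by have /eqP := bu _ fF (esym h).
    have [z [_ zF /eqP]] := pred _ _ uy fF cb.
    by rewrite (negPf (aw _ zF _)).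
  case/orP: adj => /eqP h; first by rewrite -h connect0 in uy.
  by rewrite eq_sym; apply: aw.
exists c'; split=> [e f eF fF adj|e eF]; last first.
  rewrite /c'; case: eqP => [-> //|/eqP ne].
  have /cq : e \in F' by rewrite !inE ne.
  have /= := qmin e eF; rewrite /sw; do ?case: ifP => _; lia.
have [e0|ne] := eqVneq e (u, w).
  have [f0|nf] := eqVneq f (u, w); first by move: adj; rewrite /adjacent e0 f0 eqxx.
  by rewrite {1}/c' e0 eqxx new -?e0 // !inE nf.
have eF' : e \in F' by rewrite !inE ne.
have [f0|nf] := eqVneq f (u, w).
  by rewrite {2}/c' f0 eqxx eq_sym new // -f0 adjacent_sym.
have fF' : f \in F' by rewrite !inE nf.
have := pc e f eF' fF' adj; rewrite /c' (negPf ne) (negPf nf).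
case: ifP => he; case: ifP => hf //; first by rewrite (inj_eq swI).
  move=> _; apply: mix; rewrite ?he ?hf //.
  by case/andP: adj => _ /orP[/eqP h|/eqP //]; rewrite h hf in he.
move=> _; rewrite eq_sym; apply: mix; rewrite ?he ?hf //.
by case/andP: adj => _ /orP[/eqP h|/eqP //]; rewrite h hf in he.
Qed.

(** A local form of König's edge-colouring theorem: the number of colours varies with the right end,
    as the list sizes will. Edges are added in decreasing order of [q], as [konig_extend]
    requires. *)
Lemma konig_bounded F (q : W -> nat) :
  {in F, forall e, ldeg F e.1 <= q e.2} -> {in F, forall e, rdeg F e.2 <= q e.2} ->
  exists c : U * W -> nat, proper_on F c /\ {in F, forall e, c e < q e.2}.
Proof.
have [n] := ubnP #|F|; elim: n F => // n IH F Fn hl hr.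
have [->|[e1 e1F]] := set_0Vmem F.
  by exists (fun=> 0); split=> ?; rewrite inE.
case: (arg_minnP (fun e => q e.2) e1F) => -[u w] uwF /= qmin.
have {}uwF : (u, w) \in F by [].
have [|||c [pc cq]] := IH (F :\ (u, w)).
- by move: Fn; rewrite (cardsD1 (u, w)) uwF.
- move=> e; rewrite inE => /andP[_ eF]; apply: leq_trans (hl _ eF).
  by apply/subset_leq_card/subsetP => f; rewrite !inE -andbA => /and3P[_ -> ->].
- move=> e; rewrite inE => /andP[_ eF]; apply: leq_trans (hr _ eF).
  by apply/subset_leq_card/subsetP => f; rewrite !inE -andbA => /and3P[_ -> ->].
exact: (konig_extend uwF qmin (hl _ uwF) (hr _ uwF) pc cq).
Qed.

(* A stable matching: left vertices prefer small values of [c], right vertices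
   prefer large ones. *)
Lemma stable_matching F (c : U * W -> nat) : proper_on F c ->
  exists S, [/\ S \subset F, {in S &, forall e f, ~~ adjacent e f} &
    {in F :\: S, forall e, exists2 f, f \in S &
       (f.1 == e.1) && (c f < c e) || (f.2 == e.2) && (c e < c f)}].
Proof.
have [n] := ubnP #|F|; elim: n F => // n IH F Fn pc.
(* Each left vertex proposes its favourite edge. If two proposals meet at a right vertex, the worse
   one is deleted and the induction applies; otherwise the proposals are stable. *)
pose B := [set e in F | [forall f in F, (f.1 == e.1) ==> (c e <= c f)]].
have BF e : e \in B -> e \in F by rewrite inE => /andP[].
have Bmin e f : e \in B -> f \in F -> f.1 = e.1 -> c e <= c f.
  by rewrite inE => /andP[_ /forall_inP h] fF ef; apply: (implyP (h f fF)); apply/eqP.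
have [/existsP[e /existsP[f /and5P[eB fB nef /eqP ef cef]]]|ind] :=
    boolP [exists e, exists f, [&& e \in B, f \in B, e != f, e.2 == f.2 & c e < c f]].
  have eF := BF _ eB; have fF := BF _ fB.
  have [||S [SF indS dom]] := IH (F :\ e).
  - by move: Fn; rewrite (cardsD1 e) eF.
  - exact: proper_on_sub (subsetDl _ _) pc.
  exists S; split=> //; first exact: subset_trans SF (subsetDl _ _).
  move=> g; rewrite inE => /andP[gS gF]; have [->|ne] := eqVneq g e; last first.
    by apply: dom; rewrite !inE gS ne.
  have [fS|fS] := boolP (f \in S).
    by exists f => //; rewrite -ef eqxx cef orbT.
  (* As the favourite of its left end, [f] can only be dominated at its right end, and that
     domination passes on to [e]. *)
  have [|h hS] := dom f; first by rewrite !inE fS eq_sym nef.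
  have hF : h \in F by move/subsetP: SF => /(_ _ hS); rewrite inE => /andP[].
  case/orP => /andP[/eqP h1 h2]; first by move: h2; rewrite ltnNge (Bmin _ _ fB hF h1).
  exists h => //; by rewrite h1 -ef eqxx (ltn_trans cef h2) orbT.
exists B; split; first by apply/subsetP.
  move=> e f eB fB; apply/negP => /andP[nef adj].
  have eF := BF _ eB; have fF := BF _ fB.
  have := pc e f eF fF; rewrite /adjacent nef adj => /(_ isT) nc.
  case/orP: adj => [/eqP ef|ef].
    by have := Bmin _ _ eB fF (esym ef); have := Bmin _ _ fB eF ef; lia.
  case/existsP: ind; have [lt|gt|/eqP] := ltngtP (c e) (c f); last by rewrite (negPf nc).
    by exists e; apply/existsP; exists f; rewrite eB fB nef ef.
  by exists f; apply/existsP; exists e; rewrite eB fB eq_sym nef [f.2 == _]eq_sym ef.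
move=> e; rewrite inE => /andP[eB eF].
have P0 : (e \in F) && (e.1 == e.1) by rewrite eF eqxx.
case: (@arg_minnP _ e (fun f => (f \in F) && (f.1 == e.1)) c P0) => f /andP[fF /eqP fe] fmin.
have fB : f \in B.
  rewrite inE fF; apply/forall_inP => g gF; apply/implyP => /eqP gf.
  by apply: fmin; rewrite gF gf fe /=.
exists f => //; rewrite fe eqxx /= ltn_neqAle fmin ?P0 // andbT; apply/orP; left.
by apply: pc => //; rewrite /adjacent fe eqxx andbT; apply: contraNneq eB => <-.
Qed.

(** A colour [k] is given to a stable matching among the edges that allow it. Every other such edge
    loses [k] from its list, but also loses a dominating edge, so the strict inequality survives. *)
Lemma galvin (K : finType) (k0 : K) F (c : U * W -> nat) (L : U * W -> {set K}) :
  proper_on F c ->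
  {in F, forall e, #|[set f in F | (f.1 == e.1) && (c f < c e)]| +
                   #|[set f in F | (f.2 == e.2) && (c e < c f)]| < #|L e|} ->
  exists k : U * W -> K, proper_on F k /\ {in F, forall e, k e \in L e}.
Proof.
have [n] := ubnP #|F|; elim: n F L => // n IH F L Fn pc hL.
have [->|[e1 e1F]] := set_0Vmem F.
  by exists (fun=> k0); split=> ?; rewrite inE.
have /card_gt0P[k kL] : 0 < #|L e1| by apply: leq_ltn_trans (hL _ e1F).
have [|S [SF indS dom]] := @stable_matching [set e in F | k \in L e] c.
  by apply: proper_on_sub pc; apply/subsetP => e; rewrite inE => /andP[].
have SF' e : e \in S -> (e \in F) && (k \in L e) by move/(subsetP SF); rewrite inE.
have [s sS] : exists s, s \in S.
  have [|nS] := boolP (e1 \in S); first by exists e1.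
  by have [|s sS _] := dom e1; [rewrite !inE nS e1F | exists s].
have sub_card (P : pred (U * W)) : #|[set f in F :\: S | P f]| <= #|[set f in F | P f]|.
  by apply/subset_leq_card/subsetP => f; rewrite !inE -andbA => /and3P[_ -> ->].
have lt_card (P : pred (U * W)) f : f \in S -> P f ->
    #|[set f in F :\: S | P f]| < #|[set f in F | P f]|.
  move=> fS Pf; apply/proper_card/properP; split.
    by apply/subsetP => g; rewrite !inE -andbA => /and3P[_ -> ->].
  by exists f; rewrite !inE ?fS // Pf; case/andP: (SF' _ fS) => ->.
have [|||k' [pk kL']] := IH (F :\: S) (fun e => L e :\ k).
- have : F :\: S \proper F.
    apply/properP; split; first exact: subsetDl.
    by exists s; [case/andP: (SF' _ sS) | rewrite inE sS].
  by move/proper_card; lia.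
- exact: proper_on_sub (subsetDl _ _) pc.
- move=> e; rewrite inE => /andP[eS eF]; have := hL _ eF.
  have h1 := sub_card (fun f => (f.1 == e.1) && (c f < c e)).
  have h2 := sub_card (fun f => (f.2 == e.2) && (c e < c f)).
  rewrite [#|L e|](cardsD1 k); have [kLe|kLe] := boolP (k \in L e); last first.
    by rewrite add0n; apply: leq_ltn_trans (leq_add h1 h2).
  have [|f fS] := dom e; first by rewrite !inE eS eF.
  rewrite add1n ltnS; case/orP=> Pf; apply: leq_trans.
    by rewrite -addSn; apply: leq_add h2; apply: lt_card fS Pf.
  by rewrite -addnS; apply: leq_add h1 _; apply: lt_card fS Pf.
exists (fun e => if e \in S then k else k' e); split; last first.
  move=> e eF; case: ifPn => [/SF'/andP[] //|eS].
  by have := kL' e; rewrite !inE eS eF => /(_ isT)/andP[].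
move=> e f eF fF adj; case: ifPn => eS; case: ifPn => fS.
- by have := indS _ _ eS fS; rewrite adj.
- by have := kL' f; rewrite !inE fS fF eq_sym => /(_ isT)/andP[].
- by have := kL' e; rewrite !inE eS eF => /(_ isT)/andP[].
- by apply: pk => //; rewrite inE ?eS ?fS.
Qed.

(** With the order given by a König colouring [c], an edge [e] has at most [c e] dominating edges on
    the left and [q e.2 - (c e).+1] on the right, hence fewer than [q e.2] in all. *)
Lemma bipartite_list_colouring (K : finType) (k0 : K) F (q : W -> nat) (L : U * W -> {set K}) :
  {in F, forall e, ldeg F e.1 <= q e.2} -> {in F, forall e, rdeg F e.2 <= q e.2} ->
  {in F, forall e, q e.2 <= #|L e|} ->
  exists k : U * W -> K, proper_on F k /\ {in F, forall e, k e \in L e}.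
Proof.
move=> hl hr hL; have [c [pc cq]] := konig_bounded hl hr.
apply: (galvin k0 pc) => e eF; have ce := cq _ eF; apply: leq_trans (hL _ eF).
have h1 : #|[set f in F | (f.1 == e.1) && (c f < c e)]| <= c e.
  apply: (@card_le_range _ _ c 0) => [f g|f]; rewrite !inE => /and3P[fF /eqP h ?] //.
  by case/and3P=> gF /eqP h' _; apply: proper_on_inj pc _ _ _ => //; rewrite h h' eqxx.
have h2 : #|[set f in F | (f.2 == e.2) && (c e < c f)]| <= q e.2 - (c e).+1.
  apply: (@card_le_range _ _ c (c e).+1) => [f g|f]; rewrite !inE => /and3P[fF /eqP h cef].
    by case/and3P=> gF /eqP h' _; apply: proper_on_inj pc _ _ _ => //; rewrite h h' eqxx orbT.
  by have := cq _ fF; rewrite h; lia.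
lia.
Qed.

End BipartiteColouring.

(** * Discharging *)

Section EdgeSets.
Variable T : finType.
Implicit Types (H : {set {set T}}) (f g : {set T}) (u v w : T) (X : {set T}).

Definition darts H := [set xy : T * T | [set xy.1; xy.2] \in H].

Definition edeg H v := #|nbr (darts H) v|.

Definition all_pairs H := {in H, forall f, #|f| = 2}.

Lemma in_nbr_darts H v w : (w \in nbr (darts H) v) = ([set v; w] \in H).
Proof. by rewrite !inE. Qed.

Lemma all_pairs_neq H u v : all_pairs H -> [set u; v] \in H -> u != v.
Proof. by move=> p2 /p2; rewrite cards2; case: eqP. Qed.

Lemma all_pairs_sub H H' : H' \subset H -> all_pairs H -> all_pairs H'.
Proof. by move=> /subsetP sub p2 f /sub; apply: p2. Qed.

Lemma all_pairs_mem H f u : all_pairs H -> f \in H -> u \in f -> exists v, f = [set u; v].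
Proof.
move=> p2 /p2/eqP/cards2P[x [y [nxy ->]]]; rewrite !inE => /orP[]/eqP->; first by exists y.
by exists x; rewrite setUC.
Qed.

Lemma simple_darts H : all_pairs H -> simple (darts H).
Proof.
move=> p2; split=> [x y|x]; rewrite !inE /= ?(setUC [set x]) //.
by apply/negP => /(all_pairs_neq p2); rewrite eqxx.
Qed.

Lemma edeg_sub H H' v : H' \subset H -> edeg H' v <= edeg H v.
Proof.
move=> /subsetP sub; apply/subset_leq_card/subsetP => w.
by rewrite !in_nbr_darts => /sub.
Qed.

Lemma edeg_gt0 H u v : [set u; v] \in H -> 0 < edeg H u.
Proof. by move=> uv; apply/card_gt0P; exists v; rewrite in_nbr_darts. Qed.

Lemma edeg_del H u v : [set u; v] \in H -> (edeg (H :\ [set u; v]) u).+1 <= edeg H u.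
Proof.
move=> uv; rewrite /edeg (cardsD1 v (nbr (darts H) u)) in_nbr_darts uv add1n ltnS.
apply/subset_leq_card/subsetP => w; rewrite in_setD1 !in_nbr_darts in_setD1 => /andP[n ->].
by rewrite andbT; apply: contraNneq n => ->.
Qed.

Definition touching H f := [set g in H | ~~ [disjoint g & f]].

Lemma card_touching H u v : all_pairs H -> #|touching H [set u; v]| <= edeg H u + edeg H v.
Proof.
move=> p2; pose im x := [set [set x; w] | w in nbr (darts H) x].
have sub : touching H [set u; v] \subset im u :|: im v.
  apply/subsetP => g; rewrite inE => /andP[gH /pred0Pn[x /andP[/= xg]]].
  have [w gE] := all_pairs_mem p2 gH xg; rewrite !inE => /orP[]/eqP xE; apply/orP; [left|right];
  by apply/imsetP; exists w; rewrite -xE ?in_nbr_darts // -gE.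
apply: leq_trans (subset_leq_card sub) _; apply: leq_trans (leq_card_setU _ _) _.
by apply: leq_add; apply: leq_imset_card.
Qed.

(** * Reductions for list edge-colouring *)

Definition colourable (K : finType) H (L : {set T} -> {set K}) := exists c : {set T} -> K,
  {in H &, forall f g, f != g -> ~~ [disjoint f & g] -> c f != c g} /\
  {in H, forall f, c f \in L f}.

Lemma colourable_light_edge (K : finType) H (L : {set T} -> {set K}) u v :
  all_pairs H -> [set u; v] \in H ->
  edeg (H :\ [set u; v]) u + edeg (H :\ [set u; v]) v < #|L [set u; v]| ->
  colourable (H :\ [set u; v]) L -> colourable H L.
Proof.
set f0 := [set u; v] => p2 f0H deg [c [pc cL]].
have /subsetPn[k kL kn] : ~~ (L f0 \subset [set c g | g in touching (H :\ f0) f0]).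
  apply/negP => /subset_leq_card; apply/negP; rewrite -ltnNge.
  apply: leq_ltn_trans (leq_imset_card _ _) _; apply: leq_ltn_trans deg.
  exact: card_touching (all_pairs_sub (subD1set _ _) p2).
have kn' g : g \in H -> g != f0 -> ~~ [disjoint g & f0] -> c g != k.
  move=> gH gf dis; apply: contraNneq kn => <-; apply/imsetP; exists g => //.
  by rewrite !inE gf gH.
exists (fun f => if f == f0 then k else c f); split=> [f g fH gH nfg dis|f fH]; last first.
  by case: eqP => [-> //|/eqP n]; apply: cL; rewrite !inE n.
case: (eqVneq f f0) => [fE|nf]; case: (eqVneq g f0) => [gE|ng].
- by rewrite fE gE eqxx in nfg.
- by rewrite eq_sym; apply: kn' => //; rewrite disjoint_sym -fE.
- by apply: kn' => //; rewrite -gE.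
- by apply: pc => //; rewrite !inE ?nf ?ng.
Qed.

Definition deg_into H X w := #|[set u in X | [set u; w] \in H]|.

Lemma deg_into_le H X w : deg_into H X w <= edeg H w.
Proof.
by apply/subset_leq_card/subsetP => u; rewrite in_nbr_darts inE setUC => /andP[].
Qed.

(* All edges at the independent set [X] can be coloured last: they form a
   bipartite graph whose remaining lists have at least [q w] colours. *)
Lemma colourable_alternator (K : finType) (k0 : K) H (L : {set T} -> {set K}) X (q : T -> nat) :
  all_pairs H -> (forall u w, u \in X -> [set u; w] \in H -> w \notin X) ->
  colourable [set f in H | [disjoint f & X]] L ->
  (forall u w, u \in X -> [set u; w] \in H ->
     [/\ edeg H u <= q w, deg_into H X w <= q w &
         q w + (edeg H w - deg_into H X w) <= #|L [set u; w]|]) ->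
  colourable H L.
Proof.
set H' := [set f in H | _] => p2 ind [c [pc cL]] hq.
have sub' : H' \subset H by apply/subsetP => f; rewrite inE => /andP[].
have p2' := all_pairs_sub sub' p2.
pose F := [set e : T * T | (e.1 \in X) && ([set e.1; e.2] \in H)].
pose ed (e : T * T) := [set e.1; e.2].
pose L' e := L (ed e) :\: [set c g | g in touching H' (ed e)].
have inF e : e \in F -> (e.1 \in X) * (ed e \in H) by rewrite inE => /andP[].
have [|||k [pk kL]] := @bipartite_list_colouring T T K k0 F q L'.
- move=> [u w] /inF[/= uX uw]; have [h _ _] := hq _ _ uX uw; apply: leq_trans h.
  rewrite /ldeg /edeg -(card_imset _ (can_inj (fun w => erefl : (u, w).2 = w))).
  apply/subset_leq_card/subsetP => -[x y]; rewrite !inE /= => /andP[/andP[_ xy] /eqP xE].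
  by apply/imsetP; exists y; rewrite ?in_nbr_darts -?xE.
- move=> [u w] /inF[/= uX uw]; have [_ h _] := hq _ _ uX uw; apply: leq_trans h.
  rewrite /rdeg /deg_into -(card_imset _ (can_inj (fun u => erefl : (u, w).1 = u))).
  apply/subset_leq_card/subsetP => -[x y]; rewrite !inE /= => /andP[xX /eqP yE].
  by apply/imsetP; exists x; rewrite ?inE -?yE.
- move=> [u w] /inF[/= uX uw]; have [_ _ h] := hq _ _ uX uw.
  have hI : #|L [set u; w] :&: [set c g | g in touching H' [set u; w]]| <= edeg H' u + edeg H' w.
    apply: leq_trans (card_touching u w p2'); apply: leq_trans (leq_imset_card c _).
    exact/subset_leq_card/subsetIr.
  (* No coloured edge touches [X], so only the edges at [w] that leave [X] can block colours of
     [u w]. *)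
  have d0 : edeg H' u = 0.
    apply: eq_card0 => x; rewrite in_nbr_darts !inE; apply/negbTE/negP => /andP[_ /pred0P/(_ u)].
    by rewrite /= !inE eqxx uX.
  have dw : edeg H' w + deg_into H X w <= edeg H w.
    rewrite /edeg /deg_into -cardsUI [X in _ + X](_ : _ = 0) ?addn0.
      apply/subset_leq_card/subsetP => x; rewrite inE !in_nbr_darts !inE => /orP[/andP[] //|/andP[_]].
      by rewrite setUC.
    apply: eq_card0 => x; rewrite inE in_nbr_darts !inE; apply/negbTE/negP => /andP[/andP[_ /pred0P/(_ x)]].
    by rewrite /= !inE eqxx orbT /= => -> /andP[].
  have dw' := deg_into_le H X w; rewrite /L' cardsD; move: hI h; rewrite d0 /ed /=.
  by move: #|_| #|_| => *; lia.
(* Orients an edge meeting [X] with its end in [X] first; [None] marks the edges coloured by [c]. *)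
pose enc f := [pick e in F | f == ed e].
have encF f : f \in H -> ~~ [disjoint f & X] -> exists2 e, enc f = Some e & (e \in F) && (f == ed e).
  move=> fH /pred0Pn[x /= /andP[xf xX]]; have [w fE] := all_pairs_mem p2 fH xf.
  rewrite /enc; case: pickP => [e|/(_ (x, w))]; first by exists e.
  by rewrite !inE /ed /= xX -fE fH eqxx.
have encN f : [disjoint f & X] -> enc f = None.
  move=> /pred0P dis; rewrite /enc; case: pickP => // e /andP[/inF[eX _] /eqP fE].
  by have := dis e.1; rewrite /= eX fE !inE eqxx.
have mixed f g e : e \in F -> f = ed e -> g \in H' -> ~~ [disjoint g & f] -> c g != k e.
  move=> eF fE gH' dis; have := kL _ eF; rewrite inE => /andP[+ _]; apply: contraNneq => <-.
  by apply/imsetP; exists g => //; rewrite inE gH' -fE.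
exists (fun f => if enc f is Some e then k e else c f); split=> [f g fH gH nfg dis|f fH]; last first.
  have [d|nd] := boolP [disjoint f & X].
    by rewrite encN //; apply: cL; rewrite inE fH.
  have [e -> /andP[eF /eqP fE]] := encF f fH nd.
  by have := kL _ eF; rewrite inE fE => /andP[].
have [df|ndf] := boolP [disjoint f & X]; have [dg|ndg] := boolP [disjoint g & X].
- by rewrite !encN //; apply: pc => //; rewrite inE ?fH ?gH.
- rewrite (encN f) //; have [e -> /andP[eF /eqP gE]] := encF g gH ndg.
  by apply: (mixed g) => //; rewrite inE fH.
- rewrite (encN g) //; have [e -> /andP[eF /eqP fE]] := encF f fH ndf.
  by rewrite eq_sym; apply: (mixed f) => //; rewrite ?inE ?gH // disjoint_sym.
- have [e -> /andP[eF /eqP fE]] := encF f fH ndf.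
  have [e' -> /andP[eF' /eqP gE]] := encF g gH ndg.
  apply: pk => //; rewrite /adjacent; apply/andP; split.
    by apply: contraNneq nfg => ee; rewrite fE gE ee.
  have [eX eH] := inF _ eF; have [eX' eH'] := inF _ eF'.
  case/pred0Pn: dis => x /= /andP[]; rewrite fE gE !inE.
  case/orP=> /eqP xE; case/orP=> /eqP xE'.
  - by rewrite -xE -xE' eqxx.
  - by have := ind _ _ eX' eH'; rewrite -xE' xE eX.
  - by have := ind _ _ eX eH; rewrite -xE xE' eX'.
  - by rewrite -xE -xE' eqxx orbT.
Qed.

Definition ends H := [set v | 0 < edeg H v].

(** * The minimal uncolourable set and its charge balance *)

Section Discharging.
Variables (K : finType) (k0 : K) (L : {set T} -> {set K}) (k : nat) (m : T -> nat).
Variable E : {set {set T}}.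
Hypothesis E_pairs : all_pairs E.
Hypothesis E_sparse : forall H, H \subset E -> 0 < #|ends H| -> #|darts H| < 6 * #|ends H|.
Hypothesis k_large : 17 <= k.
Hypothesis m_small : forall v, m v <= 1.
Hypothesis deg_le : forall v, edeg E v + m v <= k.
Hypothesis L_large : forall u v, [set u; v] \in E -> k < #|L [set u; v]| + m u + m v.

Let slack H v := k - (edeg H v + m v).

Lemma alternator_free_card H t : H \subset E ->
  (forall X, X != set0 -> {in X, forall u, 0 < edeg H u <= 5} ->
     exists u w, [/\ u \in X, [set u; w] \in H & deg_into H X w + slack H w < edeg H u]) ->
  t <= 5 -> #|[set v | 0 < edeg H v <= t]| <= \sum_w (t.-1 - slack H w).
Proof.
move=> HE alt t5.
(* The range of the sum records which terms are still available: once the neighbours of [w] are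
   removed from [X], they have been paid for by the term of [w], and [w] leaves the range. *)
suff main X : {in X, forall u, 0 < edeg H u <= t} ->
    #|X| <= \sum_(w | 0 < deg_into H X w) (t.-1 - slack H w).
  apply: leq_trans (main _ _) _ => [u|]; first by rewrite inE.
  by rewrite [leqRHS](bigID (fun w => 0 < deg_into H [set v | 0 < edeg H v <= t] w)) leq_addr.
have [n] := ubnP #|X|; elim: n X => // n IH X Xn Xt.
have [->|X0] := eqVneq X set0; first by rewrite cards0.
have [|u [w [uX uw small]]] := alt X X0.
  by move=> u /Xt /andP[-> h]; apply: leq_trans h t5.
have /andP[_ ut] := Xt u uX.
pose N := [set u in X | [set u; w] \in H].
have uN : u \in N by rewrite inE uX.
have cX : #|X| = #|N| + #|X :\: N|.
  by rewrite -(cardsID N X) (setIidPr _) //; apply/subsetP => x; rewrite inE => /andP[].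
have N0 : 0 < #|N| by apply/card_gt0P; exists u.
have {}IH : #|X :\: N| <= \sum_(w | 0 < deg_into H (X :\: N) w) (t.-1 - slack H w).
  apply: IH; first by move: Xn; rewrite cX ltnS; apply: leq_trans; rewrite -add1n leq_add2r.
  by move=> x; rewrite inE => /andP[_ /Xt].
rewrite cX [leqRHS](bigD1 w) //=; apply: leq_add.
  by move: small; rewrite /deg_into -/N; move: #|N| => ? ?; lia.
apply: leq_trans IH _.
rewrite [leqRHS]big_mkcond [leqLHS]big_mkcond; apply: leq_sum => x _.
case: ifP => // h; rewrite (_ : _ && _) //; apply/andP; split.
  apply: leq_trans h _; apply/subset_leq_card/subsetP => y.
  by rewrite !inE -andbA => /and3P[_ -> ->].
apply: contraTneq h => ->; rewrite -leqNgt leqn0 cards_eq0; apply/eqP/setP => y.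
by rewrite !inE; case: (y \in X); rewrite ?andbF //= andbT andNb.
Qed.

Lemma sparse_list_colourable H : H \subset E -> colourable H L.
Proof.
have [n] := ubnP #|H|; elim: n H => // n IH H Hn HE.
have p2 := all_pairs_sub HE E_pairs.
have dH v : edeg H v + m v <= k by apply: leq_trans (deg_le v); rewrite leq_add2r edeg_sub.
apply: contrapT => nc.
(* By minimality [u v] cannot be coloured last, so its other neighbouring edges are at least as many
   as its list colours. Counting [u v] at both ends adds 2 to [k + 1]. *)
have heavy u v : [set u; v] \in H -> k + 3 <= edeg H u + m u + (edeg H v + m v).
  move=> uv; have := L_large (subsetP HE _ uv).
  have vu : [set v; u] \in H by rewrite setUC.
  have := edeg_del uv; have := edeg_del vu; rewrite [[set v; u]]setUC.
  have [lt|ge] := ltnP (edeg (H :\ [set u; v]) u + edeg (H :\ [set u; v]) v) #|L [set u; v]|.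
    case: nc; apply: (colourable_light_edge p2 uv lt); apply: IH.
      by move: Hn; rewrite (cardsD1 [set u; v]) uv.
    exact: subset_trans (subD1set _ _) HE.
  by move: ge; move: #|_| (edeg _ _) (edeg _ _) (edeg _ _) (edeg _ _) => *; lia.
have alt X : X != set0 -> {in X, forall u, 0 < edeg H u <= 5} ->
    exists u w, [/\ u \in X, [set u; w] \in H & deg_into H X w + slack H w < edeg H u].
  move=> /set0Pn[x xX] X5; apply: contrapT => nex; apply: nc.
  (* With this [q] the list condition asks for [edeg H w + slack H w = k - m w] colours, which are
     available because [m u <= 1]. A failure of [edeg H u <= q w] is what [nex] excludes. *)
  apply: (colourable_alternator k0 (X := X) (q := fun w => deg_into H X w + slack H w) p2).
  (* Two adjacent vertices of [X] would give at most [5 + 1 + 5 + 1 = 12] in [heavy], against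
     [k + 3 >= 20]. *)
  - move=> u w uX uw; apply/negP => wX; have := heavy _ _ uw.
    by have := X5 _ uX; have := X5 _ wX; have := m_small u; have := m_small w; lia.
  - apply: IH; last by apply: subset_trans HE; apply/subsetP => f; rewrite inE => /andP[].
    rewrite ltnS in Hn; apply: leq_trans Hn; apply/proper_card/properP; split.
      by apply/subsetP => f; rewrite inE => /andP[].
    have /andP[/card_gt0P[y]] := X5 _ xX; rewrite in_nbr_darts => xy _.
    exists [set x; y] => //; rewrite inE xy /=; apply/pred0Pn; exists x.
    by rewrite /= xX !inE eqxx.
  - move=> u w uX uw; split; last first.
    + have := L_large (subsetP HE _ uw); have := dH w; have := m_small u; have := deg_into_le H X w.
      by rewrite /slack; move: #|_| => *; lia.
    + exact: leq_addr.
    + by rewrite leqNgt; apply/negP => lt; apply: nex; exists u, w.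
have [H0|[f fH]] := set_0Vmem H.
  by apply: nc; exists (fun=> k0); split=> ?; rewrite H0 inE.
have S0 : 0 < #|ends H|.
  have /cards2P[x [y [_ fE]]] : #|f| == 2 by rewrite p2.
  by apply/card_gt0P; exists x; rewrite inE (@edeg_gt0 _ _ y) // -fE.
have := E_sparse HE S0; rewrite ltnNge => /negP; apply.
pose lack v := 6 - edeg H v; pose rich v := edeg H v - 6.
(* A vertex of degree [d] from 1 to 5 is counted at the thresholds [d, ..., 5], that is [6 - d]
   times. *)
have lackE : \sum_(v in ends H) lack v = \sum_(t < 5) #|[set v | 0 < edeg H v <= t.+1]|.
  under [RHS]eq_bigr do rewrite -sum1_card big_mkcond /=.
  rewrite exchange_big /= big_mkcond /=; apply: eq_bigr => v _.
  under [RHS]eq_bigr do rewrite inE.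
  rewrite inE /lack !big_ord_recl big_ord0 /=; move: (edeg H v) => dv.
  by do 7?[case: dv => [|dv] //].
have le_lack : \sum_(v in ends H) lack v <= \sum_(v in ends H) rich v.
  rewrite lackE.
  apply: (@leq_trans (\sum_(t < 5) \sum_w (t - slack H w))).
    by apply: leq_sum => t _; apply: (alternator_free_card HE alt (ltn_ord t)).
  (* At slack [s <= 10] the five terms add up to at most [0 + 1 + 2 + 3 + 4 - s = 10 - s], while an
     end [w] has [rich w >= 17 - 1 - s - 6]. The case [s = 0] is tight. Outside [ends H] the slack
     is at least 16 and the sum vanishes. *)
  rewrite exchange_big /= [leqRHS]big_mkcond /=; apply: leq_sum => w _.
  rewrite inE !big_ord_recl big_ord0 /= /slack /rich /bump /=.
  have := dH w; have := m_small w; case: ifP => *; lia.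
have : \sum_(v in ends H) (6 + rich v) = \sum_(v in ends H) (edeg H v + lack v).
  by apply: eq_bigr => v _; rewrite /rich /lack; lia.
rewrite !big_split /= sum_nat_const => sumE.
have -> : #|darts H| = \sum_(v in ends H) edeg H v.
  rewrite card_sum_nbr (bigID (mem (ends H))) /= [X in _ + X]big1 ?addn0 // => v.
  by rewrite inE -leqNgt leqn0 => /eqP.
by move: sumE le_lack; rewrite mulnC; lia.
Qed.
End Discharging.
End EdgeSets.

(** * The precolouring turned into lists on the other edges *)

Theorem theorem1p9 (R : realType) (G : sgraph)
    (M : {set {set G}}) (phi : {set G} -> 'I_(max_degree G).+1) :
  planar R G ->
  17 <= max_degree G ->
  matching M ->
  exists c : {set G} -> 'I_(max_degree G).+1,
    proper_edge_colouring c /\ {in M, forall f : {set G}, c f = phi f}.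
Proof.
move=> plG k17 [ME Mdis]; set k := max_degree G in phi k17 *.
have edgeP x y : ([set x; y] \in edges G) = sedge x y.
  rewrite inE; apply/existsP/idP => [[x' /existsP[y' /andP[e /eqP E]]]|e]; last first.
    by exists x; apply/existsP; exists y; rewrite e eqxx.
  have nx : x' != y' by apply: contraTneq e => ->; rewrite sedge_irrefl.
  have : x' \in [set x; y] by rewrite E !inE eqxx.
  have : y' \in [set x; y] by rewrite E !inE eqxx orbT.
  rewrite !inE; case/orP=> /eqP yE /orP[] /eqP xE; rewrite xE yE ?eqxx // in nx e *.
  by rewrite sedge_sym.
have pE : all_pairs (edges G).
  move=> f; rewrite inE => /existsP[x /existsP[y /andP[e /eqP ->]]]; rewrite cards2.
  by case: eqP => // xy; rewrite xy sedge_irrefl in e.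
have pM := all_pairs_sub ME pE.
have m1 v : edeg M v <= 1.
  apply/card_le1P => w; rewrite in_nbr_darts => vw w'; rewrite in_nbr_darts inE.
  apply/idP/eqP => [vw'|-> //]; apply/eqP; apply: contraT => nww.
  have ne : [set v; w'] != [set v; w].
    apply/eqP => /setP/(_ w'); rewrite !inE eqxx orbT (negPf nww) orbF => /esym/eqP wv.
    by have := all_pairs_neq pM vw'; rewrite wv eqxx.
  have /pred0P/(_ v) := Mdis _ _ vw' vw ne.
  by rewrite /= !inE eqxx.
(* The colours not forbidden by precoloured neighbours. At most [edeg M u + edeg M v] of the [k + 1]
   colours are lost on [u v], whence the choice [m = edeg M]. *)
pose L f := [set c | [forall g in touching M f, phi g != c]].
have [c [pc cL]] : colourable (edges G :\: M) L.
  apply: (@sparse_list_colourable _ _ ord0 L k (edeg M) (edges G :\: M)) => //.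
  - exact: all_pairs_sub (subsetDl _ _) pE.
  - move=> H HE S0; have [p [e [d [e0 ed dr]]]] := planar_drawable plG.
    apply: (drawable_average e0 ed) S0; last 1 first.
    + apply/subsetP => -[x y] xy; rewrite inE /= !inE.
      move: xy; rewrite inE /= => xy; rewrite (edeg_gt0 xy); rewrite setUC in xy.
      by rewrite (edeg_gt0 xy).
    + exact: simple_darts (all_pairs_sub (subset_trans HE (subsetDl _ _)) pE).
    + apply: drawable_sub dr; apply/subsetP => -[x y]; rewrite !inE /= => /(subsetP HE).
      by rewrite in_setD edgeP => /andP[].
  - move=> v; apply: (@leq_trans (degree v)); last exact: leq_bigmax.
    rewrite /edeg -cardsUI [X in _ + X](_ : _ = 0) ?addn0.
      apply/subset_leq_card/subsetP => w; rewrite in_setU !in_nbr_darts inE in_setD edgeP.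
      by case/orP=> [/andP[] //|/(subsetP ME)]; rewrite edgeP.
    by apply: eq_card0 => w; rewrite in_setI !in_nbr_darts in_setD; case: (_ \in M); rewrite ?andbF.
  - move=> u v _; rewrite -addnA.
    have : ~: L [set u; v] \subset [set phi g | g in touching M [set u; v]].
      apply/subsetP => c; rewrite !inE negb_forall_in => /exists_inP[g gM].
      by rewrite negbK => /eqP <-; apply/imsetP; exists g.
    move/subset_leq_card/leq_trans => /(_ _ (leq_imset_card _ _)).
    move/leq_trans => /(_ _ (card_touching u v pM)).
    have := cardsC (L [set u; v]); rewrite card_ord.
    by move: #|_| #|_| => *; lia.
have cM f g : f \in M -> g \in edges G -> g \notin M -> ~~ [disjoint f & g] -> phi f != c g.
  move=> fM gE gM dis; have := cL g; rewrite in_setD gE gM => /(_ isT).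
  by rewrite inE => /forall_inP; apply; rewrite inE fM.
exists (fun f => if f \in M then phi f else c f); split=> [f g fE gE nfg dis|f ->] //.
case: ifPn => fM; case: ifPn => gM.
- by rewrite Mdis in dis.
- exact: cM.
- by rewrite eq_sym; apply: cM; rewrite // disjoint_sym.
- by apply: pc; rewrite // in_setD ?fM ?gM.
Qed.
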